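(* Let $\log_G:(G,\cdot)\to\mathfrak g$ and $\log_H:(H,\star)\to\mathfrak h$ be two log-Euclidean Lie groups of the same dimension, with inverse diffeomorphisms $\exp_G=\log_G^{-1}$, $\exp_H=\log_H^{-1}$. Let $\mathfrak g$ and $\mathfrak h$ be endowed with inner products (both denoted $\langle\cdot,\cdot\rangle$), and equip $G$ and $H$ with the log-Euclidean Riemannian metrics $(\log_G)^*\langle\cdot,\cdot\rangle$ and $(\log_H)^*\langle\cdot,\cdot\rangle$. Then: (a) $G$ and $H$ are isometrically isomorphic as Riemannian manifolds. (b) Any linear isometry $\psi:\mathfrak g\to\mathfrak h$ induces a unique Lie group isomorphism and Riemannian isometry $$\Phi=\exp_H\circ\,\psi\circ\log_G:G\longrightarrow H\quad\text{such that}\quad \mathrm d_{e_G}\Phi=\psi.$$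
   Context: A log-Euclidean Lie group $\phi:G\to V$ is a smooth manifold $G$ with a diffeomorphism $\phi$ onto a finite-dimensional real vector space $V$, equipped with the commutative Lie group law $u\cdot v=\phi^{-1}(\phi(u)+\phi(v))$; the identity is $e_G=\phi^{-1}(0)$. The Lie algebra $T_{e_G}G$ is identified with $V$ via $\mathrm d_{e_G}\phi$; one writes $\mathfrak g$ for $V$, $\log_G$ for $\phi$ and $\exp_G$ for $\phi^{-1}$ (the Lie exponential). Under these identifications $\mathrm d_{e_G}\log_G=\mathrm{Id}$, $\mathrm d_0\exp_H=\mathrm{Id}$, and $\mathrm d_{e_G}\Phi$ is regarded as a linear map $\mathfrak g\to\mathfrak h$. An inner product on $\mathfrak g$ is regarded as a constant Riemannian metric on $\mathfrak g$, and $(\log_G)^*\langle\cdot,\cdot\rangle$ is its pullback: $g_p(\delta,\xi)=\langle \mathrm d_p\log_G(\delta),\mathrm d_p\log_G(\xi)\rangle$. *)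

(* Defs.v *)
From HB Require Import structures.
From mathcomp Require Import all_boot all_order all_algebra.
From mathcomp Require Import sesquilinear.
From mathcomp Require Import all_classical all_reals.
From mathcomp Require Import topology normedtype landau derive.

Set Implicit Arguments.
Unset Strict Implicit.
Unset Printing Implicit Defensive.

Import Order.TTheory GRing.Theory Num.Theory.
Import passmx.
Import numFieldNormedType.Exports.

Local Open Scope classical_set_scope.
Local Open Scope ring_scope.

(* For an open set U.  As the domain is finite-dimensional, a map is C^(k+1)
   iff it is differentiable with C^k directional derivatives. *)
Fixpoint Ck_on (R : realType) (m : nat) (W : normedModType R) (k : nat)
    (U : set 'rV[R]_m) (f : 'rV[R]_m -> W) : Prop :=
  if k is k'.+1 then
    (forall x, U x -> differentiable f x) /\
    (forall v : 'rV[R]_m, Ck_on k' U ('D_v f))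
  else forall x, U x -> {for x, continuous f}.

Definition smooth_on (R : realType) (m : nat) (W : normedModType R)
    (U : set 'rV[R]_m) (f : 'rV[R]_m -> W) : Prop :=
  forall k, Ck_on k U f.

(* chart_fun is meaningful only on chart_dom, and chart_inv only on the image
   of chart_dom. *)
Record chart (R : realType) (n : nat) (M : topologicalType) := Chart {
  chart_dom : set M;
  chart_fun :> M -> 'rV[R]_n;
  chart_inv : 'rV[R]_n -> M;
  chart_dom_open : open chart_dom;
  chart_img_open : open (chart_fun @` chart_dom);
  chart_funK : forall p, chart_dom p -> chart_inv (chart_fun p) = p;
  chart_fun_continuous :
    forall p, chart_dom p -> {for p, continuous chart_fun};
  chart_inv_continuous :
    forall x, (chart_fun @` chart_dom) x -> {for x, continuous chart_inv} }.

(* chart_at selects a preferred chart around each point; it is used only to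
   represent tangent vectors by coordinates.  The atlas need not be maximal. *)
HB.mixin Record isSmoothManifold (R : realType) (n : nat) M of Topological M :=
{ atlas : set (chart R n M);
  chart_at : M -> chart R n M;
  chart_at_atlas : forall p, atlas (chart_at p);
  chart_at_dom : forall p, chart_dom (chart_at p) p;
  atlas_compatible : forall c d, atlas c -> atlas d ->
    smooth_on (c @` (chart_dom c `&` chart_dom d)) (d \o chart_inv c);
  manifold_hausdorff : hausdorff_space M;
  manifold_second_countable : @second_countable M }.

#[short(type="smoothManifoldType")]
HB.structure Definition SmoothManifold (R : realType) (n : nat) :=
  { M of Topological M & isSmoothManifold R n M }.

Definition smooth_map (R : realType) (m n : nat) (M : smoothManifoldType R m)
    (N : smoothManifoldType R n) (F : M -> N) : Prop :=
  continuous F /\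
  forall (c : chart R m M) (d : chart R n N), atlas c -> atlas d ->
    smooth_on (c @` (chart_dom c `&` F @^-1` chart_dom d))
              (d \o F \o chart_inv c).

Definition diffeomorphism (R : realType) (m n : nat)
    (M : smoothManifoldType R m) (N : smoothManifoldType R n) (F : M -> N) : Prop :=
  exists F' : N -> M,
    [/\ cancel F F', cancel F' F, smooth_map F & smooth_map F'].

(* A tangent vector at p is represented by its coordinates in the chart
   chart_at p; tangent_of_chart below gives the change of coordinates. *)
Definition tangent (R : realType) (n : nat) (M : smoothManifoldType R n)
  (p : M) : normedModType R := 'rV[R]_n.

Definition mdiff (R : realType) (m n : nat) (M : smoothManifoldType R m)
    (N : smoothManifoldType R n) (F : M -> N) (p : M) :
    {linear tangent p -> tangent (F p)} :=
  'd (chart_at (F p) \o F \o chart_inv (chart_at p)) (chart_at p p).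

(* The tangent vector at p of coordinates u in an arbitrary chart c. *)
Definition tangent_of_chart (R : realType) (n : nat)
    (M : smoothManifoldType R n) (c : chart R n M) (p : M) (u : 'rV[R]_n) :
    tangent p :=
  'd (chart_at p \o chart_inv c) (c p) u.

Record riemannianMetric (R : realType) (n : nat)
    (M : smoothManifoldType R n) := RiemannianMetric {
  metric_at :> forall p : M, {dot (tangent p) for idfun};
  metric_smooth : forall c, atlas c -> forall u v : 'rV[R]_n,
    smooth_on (c @` chart_dom c)
      (fun x => let p := chart_inv c x in
         metric_at p (tangent_of_chart c p u) (tangent_of_chart c p v)) }.

Definition riemannian_isometry (R : realType) (m n : nat)
    (M : smoothManifoldType R m) (N : smoothManifoldType R n)
    (gM : riemannianMetric M) (gN : riemannianMetric N) (F : M -> N) : Prop :=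
  diffeomorphism F /\
  forall (p : M) (u v : tangent p),
    gN (F p) (mdiff F p u) (mdiff F p v) = gM p u v.

Lemma smooth_on_id (R : realType) (m : nat) (U : set 'rV[R]_m) :
  smooth_on U (id : 'rV[R]_m -> 'rV[R]_m).
Proof.
have cstS (c : 'rV[R]_m) k : Ck_on k U (cst c).
  elim: k c => [|k IHk] c /=; first by move=> x _; exact: cst_continuous.
  split=> [x _|v]; first exact: differentiable_cst.
  rewrite (_ : 'D_v (cst c) = cst 0) ?funeqE//.
  by move=> x; rewrite derive_cst.
case=> [|k] /=; first by move=> x _; exact: cvg_id.
split=> [x _|v]; first by apply: ex_diff.
rewrite (_ : 'D_v id = cst v) ?funeqE//.
by move=> x; rewrite derive_id.
Qed.

Lemma rV_second_countable (R : realType) (n : nat) :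
  @second_countable 'rV[R]_n.
Proof.
pose f (qk : 'rV[rat]_n * nat) : set 'rV[R]_n :=
  ball (map_mx ratr qk.1 : 'rV[R]_n) (qk.2.+1%:R^-1 : R).
exists (range f); first exact: sub_countable (card_image_le _ _) (countableP _).
split=> [_ [qk _ <-]|x V /nbhs_ballP [e /= e0 xeV]].
  by apply: ball_open; rewrite invr_gt0.
have [k ke] : exists k, k.+1%:R^-1 < e / 2.
  have e20 : 0 < e / 2 by rewrite divr_gt0.
  by have [k] := ltr_add_invr e20; rewrite add0r; exists k.
have k0 : 0 < k.+1%:R^-1 :> R by rewrite invr_gt0.
have [q xq] : exists q : 'rV[rat]_n,
    ball x (k.+1%:R^-1 : R) (map_mx ratr q : 'rV[R]_n).
  have Hq j : exists r : rat, ball (x ord0 j) (k.+1%:R^-1 : R) (ratr r).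
    have [y [xy [r _ ry]]] := @dense_rat R _
      (ex_intro _ (x ord0 j) (ballxx (x ord0 j) k0)) (ball_open (x ord0 j) _).
    by exists r; rewrite ry.
  exists (\row_j projT1 (cid (Hq j))); split=> // i j; rewrite !mxE (ord1 i).
  exact: (projT2 (cid (Hq j))).
exists (f (q, k)); first split.
- by exists (q, k).
- exact/ball_sym.
move=> y /= qy; apply: xeV; apply: (@le_ball _ _ _ (k.+1%:R^-1 + k.+1%:R^-1)).
  by rewrite [leRHS](splitr e) lerD // ltW.
exact: (ball_triangle xq qy).
Qed.

(* A finite-dimensional real vector space V with its usual topology and smooth
   structure, given by linear coordinates. *)
Definition vmanifold (R : realType) (V : vectType R) : Type :=
  initial_topology (rVof (vbasis {:V})).

HB.instance Definition _ (R : realType) (V : vectType R) :=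
  Topological.copy (vmanifold V) (initial_topology (rVof (vbasis {:V}))).

Section VManifold.
Context {R : realType} {V : vectType R}.
Local Notation coords := (rVof (vbasis {:V}) : vmanifold V -> 'rV[R]_(\dim {:V})).
Local Notation point :=
  (vecof (vbasis {:V}) : 'rV[R]_(\dim {:V}) -> vmanifold V).

Let coordsK : cancel coords point. Proof. exact/rVofK/vbasisP. Qed.
Let pointK : cancel point coords. Proof. exact/vecofK/vbasisP. Qed.

Let coords_image (A : set (vmanifold V)) : coords @` A = point @^-1` A.
Proof.
apply/seteqP; split=> [_ [v Av <-]|x Ax] /=; first by rewrite coordsK.
by exists (point x).
Qed.

Let coords_continuous : continuous coords.
Proof. exact: initial_continuous. Qed.

Let point_continuous : continuous point.
Proof.
apply/continuousP => _ [B oB <-].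
rewrite (_ : _ @^-1` _ = B) //; apply/seteqP.
by split=> x /=; rewrite pointK.
Qed.

Lemma vchart_img_open : open (coords @` [set: vmanifold V]).
Proof. by rewrite coords_image; exact: openT. Qed.

Definition vchart : chart R (\dim {:V}) (vmanifold V) :=
  @Chart R (\dim {:V}) (vmanifold V) setT coords point openT vchart_img_open
    (fun v _ => coordsK v) (fun v _ => @coords_continuous v)
    (fun x _ => @point_continuous x).

Lemma vmanifold_compatible (c d : chart R (\dim {:V}) (vmanifold V)) :
  [set vchart] c -> [set vchart] d ->
  smooth_on (c @` (chart_dom c `&` chart_dom d)) (d \o chart_inv c).
Proof.
move=> -> ->; rewrite (_ : vchart \o chart_inv vchart = id).
  exact: smooth_on_id.
by rewrite funeqE => x /=; exact: pointK.
Qed.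

Lemma vmanifold_hausdorff : hausdorff_space (vmanifold V).
Proof.
move=> p q pq; apply: (can_inj coordsK); apply: norm_hausdorff.
move=> A B /coords_continuous pA /coords_continuous qB.
by have [v [Av Bv]] := pq _ _ pA qB; exists (coords v).
Qed.

Lemma vmanifold_second_countable : @second_countable (vmanifold V).
Proof.
have [B cB [oB bB]] := rV_second_countable R (\dim {:V}).
exists ((fun A => coords @^-1` A) @` B); first exact: sub_countable (card_image_le _ _) cB.
split=> [_ [A BA <-]|v A vA].
  by exists A => //; exact: oB.
have {}vA : nbhs (coords v) (point @^-1` A).
  by apply: point_continuous; rewrite coordsK.
have [C [BC Cv] CA] := bB _ _ vA.
exists (coords @^-1` C); first by split=> //; exists C.
by move=> w /= /CA /=; rewrite coordsK.
Qed.

HB.instance Definition _ := isSmoothManifold.Build R (\dim {:V}) (vmanifold V)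
  (fun _ => erefl : [set vchart] vchart) (fun _ => I)
  vmanifold_compatible vmanifold_hausdorff vmanifold_second_countable.

(* The identification of the tangent spaces of V with V. *)
Definition tangent_vect (v : vmanifold V) (u : tangent v) : V :=
  vecof (vbasis {:V}) u.

End VManifold.


(* The group law is the one transported from V by the logarithm. *)
HB.mixin Record isLogEuclidean (R : realType) (n : nat) (V : vectType R) G
    of SmoothManifold R n G & Group G := {
  le_log : G -> V;
  le_exp : V -> G;
  le_logK : cancel le_log le_exp;
  le_expK : cancel le_exp le_log;
  le_log_smooth : smooth_map (le_log : G -> vmanifold V);
  le_exp_smooth : smooth_map (le_exp : vmanifold V -> G);
  le_mulE : forall x y : G, (x * y)%g = le_exp (le_log x + le_log y) }.

#[short(type="logEuclideanGroupType")]
HB.structure Definition LogEuclideanGroup (R : realType) (n : nat)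
    (V : vectType R) :=
  { G of isLogEuclidean R n V G & SmoothManifold R n G & Group G }.

Lemma le_exp0 (R : realType) (n : nat) (V : vectType R)
    (G : logEuclideanGroupType n V) : le_exp 0 = 1%g :> G.
Proof.
have := congr1 le_log (le_mulE (1 : G)%g 1%g).
rewrite mulg1 le_expK -[LHS]addr0 => /addrI log10.
by rewrite log10 le_logK.
Qed.

Lemma le_mulC (R : realType) (n : nat) (V : vectType R)
    (G : logEuclideanGroupType n V) (x y : G) : (x * y = y * x)%g.
Proof. by rewrite !le_mulE addrC. Qed.

(* The differential of the logarithm at p, as a map from T_p G to V. *)
Definition le_dlog (R : realType) (n : nat) (V : vectType R)
    (G : logEuclideanGroupType n V) (p : G) (u : tangent p) : V :=
  tangent_vect (mdiff (le_log : G -> vmanifold V) p u).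

Lemma le_dlog_linear (R : realType) (n : nat) (V : vectType R)
    (G : logEuclideanGroupType n V) (p : G) : linear (@le_dlog R n V G p).
Proof. by move=> a u v; rewrite /le_dlog /tangent_vect !linearP. Qed.
HB.instance Definition _ (R : realType) (n : nat) (V : vectType R)
    (G : logEuclideanGroupType n V) (p : G) :=
  GRing.isLinear.Build R (tangent p) V _ (@le_dlog R n V G p)
    (@le_dlog_linear R n V G p).

Section Calculus.
Context {R : realType}.

Lemma near_eq_diff (V W : normedModType R) (f g : V -> W) (x : V) :
  {near x, f =1 g} -> differentiable f x ->
  differentiable g x /\ 'd g x = 'd f x :> (V -> W).
Proof.
move=> fg df.
have dg : g \o shift x = cst (g x) + 'd f x +o_ 0 id.
  apply/eqaddoP => e e0; have /eqaddoP/(_ e e0) H := diff_locally df.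
  have fg0 : \forall h \near (0 : V), f (h + x) = g (h + x).
    by have := fg; rewrite (near_shift 0 x); apply: filterS => h /=; rewrite subr0.
  have fgx : f x = g x by exact: (nbhs_singleton fg).
  near=> h.
  have -> : (g \o shift x - (cst (g x) + 'd f x)) h =
            (f \o shift x - (cst (f x) + 'd f x)) h.
    have /= E : f (h + x) = g (h + x) by near: h.
    by rewrite /= !fctE /= E fgx.
  by near: h.
have E := diff_unique (diff_continuous df) dg.
split=> //; apply/diff_locallyP; rewrite E; split=> //.
exact: diff_continuous df.
Unshelve. all: by end_near. Qed.

Lemma diff_chain (V1 V2 V3 : normedModType R) (f : V1 -> V2) (g : V2 -> V3)
    (h : V1 -> V3) (x : V1) (y : V2) (u : V1) :
  f x = y -> differentiable f x -> differentiable g y ->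
  {near x, g \o f =1 h} -> 'd g y ('d f x u) = 'd h x u.
Proof.
move=> <- df dg gfh.
rewrite (near_eq_diff gfh (differentiable_comp df dg)).2.
by rewrite (diff_comp df dg).
Qed.

End Calculus.

Section SmoothFunctions.
Context {R : realType} {m : nat}.
Implicit Types (W : normedModType R) (U : set 'rV[R]_m).

Lemma eq_Ck_on W k U (f g : 'rV[R]_m -> W) :
  open U -> (forall x, U x -> f x = g x) -> Ck_on k U f -> Ck_on k U g.
Proof.
move=> oU; have near_fg (h h' : 'rV[R]_m -> W) x :
    (forall x, U x -> h x = h' x) -> U x -> {near x, h =1 h'}.
  move=> hh' Ux; apply: filterS (open_nbhs_nbhs (conj oU Ux)) => y Uy.
  exact: hh'.
elim: k f g => [|k IHk] f g fg /=.
  move=> cf x Ux; have nfg := near_fg _ _ _ fg Ux.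
  rewrite /prop_for /continuous_at -(fg _ Ux).
  exact: cvg_trans (near_eq_cvg nfg) (cf x Ux).
move=> [df Df]; split=> [x Ux|v].
  exact: (near_eq_diff (near_fg _ _ _ fg Ux) (df x Ux)).1.
apply: IHk (Df v) => x Ux; exact: near_eq_derive (near_fg _ _ _ fg Ux).
Qed.

Lemma smooth_on_derive W U (f : 'rV[R]_m -> W) v :
  smooth_on U f -> smooth_on U ('D_v f).
Proof. by move=> sf k; have [_ Df] := sf k.+1; exact: Df. Qed.

Lemma smooth_on_differentiable W U (f : 'rV[R]_m -> W) x :
  smooth_on U f -> U x -> differentiable f x.
Proof. by move=> sf Ux; have [df _] := sf 1%N; exact: df. Qed.

Lemma smooth_on_continuous W U (f : 'rV[R]_m -> W) x :
  smooth_on U f -> U x -> {for x, continuous f}.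
Proof. by move=> sf; exact: (sf 0%N x). Qed.

Lemma smooth_on_cst W U (a : W) : smooth_on U (cst a : 'rV[R]_m -> W).
Proof.
move=> k; elim: k a => [|k IHk] a /=; first by move=> x _; exact: cst_continuous.
split=> [x _|v]; first exact: differentiable_cst.
rewrite (_ : 'D_v (cst a) = cst 0) ?funeqE//.
by move=> x; rewrite derive_cst.
Qed.

Lemma smooth_onD W U (f g : 'rV[R]_m -> W) : open U ->
  smooth_on U f -> smooth_on U g -> smooth_on U (f + g).
Proof.
move=> oU sf sg k; elim: k f g sf sg => [|k IHk] f g sf sg /=.
  move=> x Ux; apply: continuousD.
    exact: smooth_on_continuous sf Ux.
  exact: smooth_on_continuous sg Ux.
split=> [x Ux|v].
  apply: differentiableD.
    exact: smooth_on_differentiable sf Ux.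
  exact: smooth_on_differentiable sg Ux.
apply: eq_Ck_on (IHk _ _ (smooth_on_derive v sf) (smooth_on_derive v sg)) => //.
move=> x Ux; rewrite deriveD//; apply: diff_derivable.
  exact: smooth_on_differentiable sf Ux.
exact: smooth_on_differentiable sg Ux.
Qed.

Lemma smooth_onM U (f g : 'rV[R]_m -> R) : open U ->
  smooth_on U f -> smooth_on U g -> smooth_on U (f * g).
Proof.
move=> oU sf sg k.
suff : forall f g : 'rV[R]_m -> R, smooth_on U f -> smooth_on U g ->
  Ck_on k U (f * g) by exact.
elim: k {f g sf sg} => [|k IHk] f g sf sg /=.
  move=> x Ux; apply: continuousM.
    exact: smooth_on_continuous sf Ux.
  exact: smooth_on_continuous sg Ux.
have df x : U x -> differentiable f x by exact: smooth_on_differentiable.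
have dg x : U x -> differentiable g x by exact: smooth_on_differentiable.
split=> [x Ux|v]; first by apply: differentiableM; [exact: df|exact: dg].
have Ck_onD (f1 f2 : 'rV[R]_m -> R) :
    Ck_on k U f1 -> Ck_on k U f2 -> Ck_on k U (f1 + f2).
  elim: {IHk} k f1 f2 => [|k IHk] f1 f2 /=.
    by move=> c1 c2 x Ux; apply: continuousD; [exact: c1|exact: c2].
  move=> [d1 D1] [d2 D2]; split=> [x Ux|w].
    by apply: differentiableD; [exact: d1|exact: d2].
  apply: eq_Ck_on (IHk _ _ (D1 w) (D2 w)) => // x Ux.
  by rewrite deriveD//; apply: diff_derivable; [exact: d1|exact: d2].
apply: (@eq_Ck_on _ _ _ (f * 'D_v g + g * 'D_v f)) => // [x Ux|].
  by rewrite deriveM//; apply: diff_derivable; [exact: df|exact: dg].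
by apply: Ck_onD; apply: IHk => //; exact: smooth_on_derive.
Qed.

Lemma smooth_on_coord n U (f : 'rV[R]_m -> 'rV[R]_n) j : open U ->
  smooth_on U f -> smooth_on U (fun x => f x ord0 j).
Proof.
move=> oU sf k; elim: k f sf => [|k IHk] f sf /=.
  move=> x Ux; apply: (@continuous_comp _ _ _ f (fun M => M ord0 j)).
    exact: smooth_on_continuous sf Ux.
  exact: coord_continuous.
have df x : U x -> differentiable f x by exact: smooth_on_differentiable.
split=> [x Ux|v].
  exact: (differentiable_comp (df x Ux) (differentiable_coord _ _ _)).
apply: eq_Ck_on (IHk _ (smooth_on_derive v sf)) => // x Ux.
by rewrite derive_mx ?mxE//; apply: diff_derivable; exact: df.
Qed.

Lemma smooth_on_sum (I : Type) (r : seq I) U (f : I -> 'rV[R]_m -> R) :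
  open U -> (forall i, smooth_on U (f i)) ->
  smooth_on U (fun x => \sum_(i <- r) f i x).
Proof.
move=> oU sf; elim: r => [|i r IHr].
  rewrite (_ : (fun _ => _) = cst 0); first exact: smooth_on_cst.
  by rewrite funeqE => x; rewrite big_nil.
rewrite (_ : (fun _ => _) = f i + (fun x => \sum_(j <- r) f j x)).
  exact: smooth_onD.
by rewrite funeqE => x; rewrite big_cons.
Qed.

Lemma smooth_on_dot n U (V : vectType R) (ip : {dot V for idfun})
    (L : {linear 'rV[R]_n -> V}) (f g : 'rV[R]_m -> 'rV[R]_n) : open U ->
  smooth_on U f -> smooth_on U g -> smooth_on U (fun x => ip (L (f x)) (L (g x))).
Proof.
move=> oU sf sg.
pose F i j : 'rV[R]_m -> R := (fun x => f x ord0 i) *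
  ((fun x => g x ord0 j) * cst (ip (L (delta_mx 0 i)) (L (delta_mx 0 j)))).
rewrite (_ : (fun _ => _) = (fun x => \sum_i \sum_j F i j x)); last first.
  rewrite funeqE => x; rewrite {1}[f x]row_sum_delta {1}[g x]row_sum_delta.
  rewrite (linear_sum L) linear_sumlz; apply: eq_bigr => i _.
  rewrite (linear_sum L) linear_sumr; apply: eq_bigr => j _.
  rewrite !linearZ /= linearZl_LR /= mulrCA.
  by [].
apply: smooth_on_sum => // i.
apply: smooth_on_sum => // j.
apply: smooth_onM => //; first exact: smooth_on_coord.
by apply: smooth_onM => //; [exact: smooth_on_coord|exact: smooth_on_cst].
Qed.
End SmoothFunctions.

Lemma chart_image_open (R : realType) (n : nat) (M : topologicalType)
    (c : chart R n M) (A : set M) : open A -> open (c @` (chart_dom c `&` A)).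
Proof.
move=> oA; rewrite openE => _ [p [cp Ap] <-].
have icp : (c @` chart_dom c) (c p) by exists p.
have nA : nbhs (c p) (chart_inv c @^-1` A).
  apply: (chart_inv_continuous icp); rewrite (chart_funK cp).
  exact: (open_nbhs_nbhs (conj oA Ap)).
have nD : nbhs (c p) (c @` chart_dom c).
  by apply: open_nbhs_nbhs; split=> //; exact: chart_img_open.
apply: filterS2 nA nD => y + [q cq cqy]; rewrite -cqy /= (chart_funK cq) => Aq.
by exists q.
Qed.

Section LogMetric.
Context {R : realType} {n : nat} {V : vectType R}.
Variable G : logEuclideanGroupType n V.

Let log_in (c : chart R n G) (x : 'rV[R]_n) : 'rV[R]_(\dim {:V}) :=
  rVof (vbasis {:V}) (le_log (chart_inv c x)).

Let log_in_smooth (c : chart R n G) : atlas c ->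
  smooth_on (c @` chart_dom c) (log_in c).
Proof.
move=> ac; have [_ /(_ c vchart ac erefl)] := le_log_smooth (s := G).
by rewrite preimage_setT setIT.
Qed.

Let log_in_diff (c : chart R n G) (p : G) : atlas c -> chart_dom c p ->
  differentiable (log_in c) (c p).
Proof.
move=> ac cp; apply: (smooth_on_differentiable (log_in_smooth ac)).
by exists p.
Qed.

Lemma le_dlog_tangent_of_chart (c : chart R n G) (p : G) (u : 'rV[R]_n) :
  atlas c -> chart_dom c p ->
  le_dlog (tangent_of_chart c p u) =
  vecof (vbasis {:V}) ('d (log_in c) (c p) u).
Proof.
move=> ac cp; set c0 := chart_at p.
have c0p : chart_dom c0 p by exact: chart_at_dom.
have ac0 : atlas c0 by exact: chart_at_atlas.
rewrite /le_dlog /tangent_vect; congr vecof.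
rewrite -[LHS]/('d (log_in c0) (c0 p) ('d (c0 \o chart_inv c) (c p) u)).
set B := c0 \o chart_inv c.
have iU : (c @` (chart_dom c `&` chart_dom c0)) (c p) by exists p.
have dB : differentiable B (c p).
  exact: (smooth_on_differentiable (atlas_compatible _ _ ac ac0) iU).
have Bcp : B (c p) = c0 p by rewrite /B /= (chart_funK cp).
have dL : differentiable (log_in c0) (c0 p) by exact: log_in_diff.
have eqF : {near c p, log_in c0 \o B =1 log_in c}.
  have : nbhs (c p) (c @` (chart_dom c `&` chart_dom c0)).
    apply: open_nbhs_nbhs; split=> //; exact/chart_image_open/chart_dom_open.
  apply: filterS => _ [q [cq c0q] <-] /=.
  by rewrite /B /log_in /= (chart_funK cq) (chart_funK c0q).
exact: diff_chain Bcp dB dL eqF.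
Qed.

Lemma le_dlog_inj (p : G) : injective (@le_dlog R n V G p).
Proof.
set c := chart_at p; set L := log_in c; set x := c p.
have ac : atlas c by exact: chart_at_atlas.
have cp : chart_dom c p by exact: chart_at_dom.
pose E (y : 'rV[R]_(\dim {:V})) := c (le_exp (vecof (vbasis {:V}) y)).
have bV := vbasisP {:V}.
have dL : differentiable L x by exact: log_in_diff.
have ELq q : chart_dom c q -> E (L (c q)) = c q.
  by move=> cq; rewrite /E /L /log_in (chart_funK cq) rVofK ?le_logK.
have dE : differentiable E (L x).
  have [_ /(_ vchart c erefl ac)] := le_exp_smooth (s := G).
  move/smooth_on_differentiable; apply.
  exists (le_log p) => /=; last by rewrite /L /log_in /x (chart_funK cp).
  by split=> //=; rewrite le_logK.
have EL : {near x, E \o L =1 id}.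
  have : nbhs x (c @` chart_dom c).
    by apply: open_nbhs_nbhs; split; [exact: chart_img_open|exists p].
  by apply: filterS => _ [q cq <-]; rewrite /= ELq.
have dEL (u : 'rV[R]_n) : 'd E (L x) ('d L x u) = u.
  rewrite (diff_chain u erefl dL dE EL).
  by rewrite diff_val.
move=> u v /(can_inj (vecofK bV)) uv.
by rewrite -[u]dEL -[v]dEL; congr ('d E (L x) _).
Qed.

Section Pullback.
Variable ip : {dot V for idfun}.

Definition log_pullback (p : G) (u v : tangent p) : R :=
  ip (le_dlog u) (le_dlog v).

Lemma log_pullback_bilinear (p : G) : bilinear_for *%R *%R (@log_pullback p).
Proof.
split=> [v a u u'|u a v v']; rewrite /log_pullback linearP.
  by rewrite linearPl.
by rewrite linearPr.
Qed.

Lemma log_pullback_sym (p : G) (u v : tangent p) :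
  log_pullback u v = (-1) ^+ false * idfun (log_pullback v u).
Proof. exact: hermC. Qed.

Lemma log_pullback_gt0 (p : G) (u : tangent p) :
  u != 0 -> 0 < log_pullback u u.
Proof.
move=> u0; apply: neq0_dnorm_gt0; apply: contra_neq u0 => du0.
by apply: (@le_dlog_inj p); rewrite du0 linear0.
Qed.

HB.instance Definition _ (p : G) :=
  @bilinear_isBilinear.Build R (tangent p) (tangent p) R *%R (idfun \; *%R)
    (@log_pullback p) (@log_pullback_bilinear p).
HB.instance Definition _ (p : G) :=
  @isHermitianSesquilinear.Build R (tangent p) false idfun
    (@log_pullback p) (@log_pullback_sym p).
HB.instance Definition _ (p : G) :=
  @isDotProduct.Build R (tangent p) (@log_pullback p) (@log_pullback_gt0 p).

Lemma log_pullback_smooth (c : chart R n G) : atlas c -> forall u v : 'rV[R]_n,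
  smooth_on (c @` chart_dom c)
    (fun x => let p := chart_inv c x in
       log_pullback (tangent_of_chart c p u) (tangent_of_chart c p v)).
Proof.
move=> ac u v.
have oU : open (c @` chart_dom c) by exact: chart_img_open.
have sL w : smooth_on (c @` chart_dom c) ('D_w (log_in c)).
  exact/smooth_on_derive/log_in_smooth.
move=> k; apply: eq_Ck_on (smooth_on_dot ip
  (vecof (vbasis {:V}) : {linear _ -> _}) oU (sL u) (sL v) k) => //.
move=> _ [p cp <-]; rewrite /log_pullback !(chart_funK cp).
by rewrite !le_dlog_tangent_of_chart// !deriveE//; exact: log_in_diff.
Qed.

Definition log_metric : riemannianMetric G :=
  @RiemannianMetric R n G (fun p => @log_pullback p : {dot (tangent p) for idfun})
    log_pullback_smooth.

End Pullback.
End LogMetric.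

Definition lie_group_isomorphism (R : realType) (m n : nat) (V W : vectType R)
    (G : logEuclideanGroupType m V) (H : logEuclideanGroupType n W)
    (F : G -> H) : Prop :=
  diffeomorphism F /\ {morph F : x y / (x * y)%g}.

(* The differential of F at the identity, read through the identifications of
   the Lie algebras with V and W, is f. *)
Definition lie_differential (R : realType) (m n : nat) (V W : vectType R)
    (G : logEuclideanGroupType m V) (H : logEuclideanGroupType n W)
    (F : G -> H) (f : V -> W) : Prop :=
  forall u : tangent (1%g : G), le_dlog (mdiff F 1%g u) = f (le_dlog u).

(* Main.v *)
(* In logarithmic coordinates [exp_H \o psi \o log_G] is the linear map [psi]:
   by the chain rule its differential, read through the differentials of the
   logarithms, is [psi] at every point, so it is an isometry when [psi] is.
   Since both groups have the same dimension, orthonormal bases give such a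
   [psi].  Conversely a smooth morphism [Psi] becomes in logarithmic coordinates
   an additive map differentiable at 0, hence equal to its differential there. *)
Require Import Defs.
From HB Require Import structures.
From mathcomp Require Import all_boot all_order all_algebra.
From mathcomp Require Import sesquilinear.
From mathcomp Require Import all_classical all_reals.
From mathcomp Require Import topology normedtype landau derive.
From mathcomp Require Import sequences.

Set Implicit Arguments.
Unset Strict Implicit.
Unset Printing Implicit Defensive.

Import Order.TTheory GRing.Theory Num.Theory.
Import passmx.
Import numFieldNormedType.Exports.

Local Open Scope classical_set_scope.
Local Open Scope ring_scope.

(** * Functions of class C^k on coordinate spaces, up to composition *)

Section SmoothComposition.
Context {R : realType} {m : nat}.
Implicit Types (W : normedModType R) (U : set 'rV[R]_m).

Lemma eq_smooth_on W U (f g : 'rV[R]_m -> W) :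
  open U -> (forall x, U x -> f x = g x) -> smooth_on U f -> smooth_on U g.
Proof. by move=> oU fg sf k; apply: eq_Ck_on fg (sf k). Qed.

Lemma Ck_onS W k U (f : 'rV[R]_m -> W) : Ck_on k.+1 U f -> Ck_on k U f.
Proof.
elim: k f => [|k IHk] f [df Df] /=.
  by move=> x Ux; exact: differentiable_continuous (df x Ux).
by split=> // v; exact: IHk (Df v).
Qed.

Lemma Ck_onD W k U (f g : 'rV[R]_m -> W) : open U ->
  Ck_on k U f -> Ck_on k U g -> Ck_on k U (f + g).
Proof.
move=> oU; elim: k f g => [|k IHk] f g /=.
  by move=> cf cg x Ux; apply: continuousD; [exact: cf|exact: cg].
move=> [df Df] [dg Dg]; split=> [x Ux|v].
  by apply: differentiableD; [exact: df|exact: dg].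
apply: eq_Ck_on (IHk _ _ (Df v) (Dg v)) => // x Ux.
by rewrite deriveD//; apply: diff_derivable; [exact: df|exact: dg].
Qed.

(** Products are handled at a fixed order [k] because the induction in [smooth_on_comp] controls one
    of its factors only to that order. By Leibniz' rule the derivative pairs each function with a
    derivative of the other, so [Ck_onS] lowers the underived factor by one order. *)
Lemma Ck_onM k U (f g : 'rV[R]_m -> R) : open U ->
  Ck_on k U f -> Ck_on k U g -> Ck_on k U (f * g).
Proof.
move=> oU; elim: k f g => [|k IHk] f g.
  by move=> cf cg x Ux; apply: continuousM; [exact: cf|exact: cg].
move=> Cf Cg; have [df Df] := Cf; have [dg Dg] := Cg; split=> [x Ux|v].
  by apply: differentiableM; [exact: df|exact: dg].
apply: (@eq_Ck_on _ _ _ _ _ (f * 'D_v g + g * 'D_v f)) => // [x Ux|].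
  by rewrite deriveM//; apply: diff_derivable; [exact: df|exact: dg].
apply: (Ck_onD oU); apply: IHk; [|exact: Dg| |exact: Df].
  exact: Ck_onS.
exact: Ck_onS.
Qed.

Lemma Ck_on_sum W (I : Type) (r : seq I) k U (f : I -> 'rV[R]_m -> W) :
  open U -> (forall i, Ck_on k U (f i)) ->
  Ck_on k U (fun x => \sum_(i <- r) f i x).
Proof.
move=> oU sf; elim: r => [|i r IHr].
  rewrite (_ : (fun _ => _) = cst 0); first exact: smooth_on_cst.
  by rewrite funeqE => x; rewrite big_nil.
rewrite (_ : (fun _ => _) = f i + (fun x => \sum_(j <- r) f j x)).
  exact: Ck_onD.
by rewrite funeqE => x; rewrite big_cons.
Qed.

Lemma Ck_onZl W k U (f : 'rV[R]_m -> R) (w : W) : open U ->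
  Ck_on k U f -> Ck_on k U (fun x => f x *: w).
Proof.
move=> oU; elim: k f => [|k IHk] f.
  by move=> cf x Ux; apply: continuousZr_tmp; exact: (cf x Ux).
move=> [df Df]; split=> [x Ux|v]; first exact: differentiableZl (df x Ux).
apply: eq_Ck_on (IHk _ (Df v)) => // x Ux.
have dfx := df x Ux.
by rewrite [RHS]deriveE; [rewrite diffZl// deriveE|exact: differentiableZl].
Qed.

Lemma smooth_on_row n U (f : 'rV[R]_m -> 'rV[R]_n) : open U ->
  (forall j, smooth_on U (fun x => f x ord0 j)) -> smooth_on U f.
Proof.
move=> oU sf k; rewrite (_ : f = fun x => \sum_j f x ord0 j *: 'e_j).
  by apply: Ck_on_sum => // j; apply: Ck_onZl => //; exact: sf.
by rewrite funeqE => x; rewrite {1}[f x]row_sum_delta.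
Qed.

(** A linear map on rows is a finite sum of coordinates times the fixed vectors [L 'e_j], and the
    coordinates are smooth. *)
Lemma smooth_on_linear W U (L : {linear 'rV[R]_m -> W}) :
  open U -> smooth_on U L.
Proof.
move=> oU k; rewrite (_ : (L : _ -> _) = fun x => \sum_j x ord0 j *: L 'e_j).
  apply: Ck_on_sum => // j; apply: Ck_onZl => //.
  exact: (smooth_on_coord j oU (@smooth_on_id _ _ U) k).
rewrite funeqE => x; rewrite {1}[x]row_sum_delta linear_sum.
by apply: eq_bigr => j _; rewrite linearZ.
Qed.

Lemma rV_linear_continuous W (L : {linear 'rV[R]_m -> W}) : continuous L.
Proof.
by move=> x; exact: smooth_on_continuous (smooth_on_linear L openT) I.
Qed.

End SmoothComposition.

(** It suffices to treat the coordinates of [g], that is, scalar functions [h]. The chain rule gives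
    ['D_v (h \o f)] as the sum over [j] of [('D_v f)_j * ('D_('e_j) h \o f)]. Each partial
    derivative of [h] is again smooth, so an induction on the order, general in [h], applies to the
    second factor. *)
Lemma smooth_on_comp (R : realType) (l m n : nat)
    (U : set 'rV[R]_l) (V : set 'rV[R]_m)
    (f : 'rV[R]_l -> 'rV[R]_m) (g : 'rV[R]_m -> 'rV[R]_n) :
  open U -> open V -> (forall x, U x -> V (f x)) ->
  smooth_on U f -> smooth_on V g -> smooth_on U (g \o f).
Proof.
move=> oU oV fUV sf sg.
suff smooth_scalar (h : 'rV[R]_m -> R) : smooth_on V h -> smooth_on U (h \o f).
  apply: smooth_on_row => // i; exact: smooth_scalar (smooth_on_coord i oV sg).
have df x : U x -> differentiable f x by exact: smooth_on_differentiable.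
have dg (h0 : _ -> R) x : smooth_on V h0 -> U x -> differentiable h0 (f x).
  by move=> sh0 /fUV; exact: smooth_on_differentiable.
move=> + k; elim: k h => [|k IHk] h sh.
  move=> x Ux; apply: continuous_comp.
    exact: differentiable_continuous (df x Ux).
  exact: differentiable_continuous (dg h x sh Ux).
split=> [x Ux|v].
  by apply: differentiable_comp; [exact: df|exact: dg].
pose F j x := ('D_v f x) ord0 j * ('D_('e_j) h \o f) x.
apply: (@eq_Ck_on _ _ _ _ _ (fun x => \sum_j F j x)) => // [x Ux|].
  have [dfx dhx] := (df x Ux, dg h x sh Ux).
  rewrite [RHS]deriveE; last exact: differentiable_comp.
  rewrite diff_comp//= -(deriveE v dfx) (row_sum_delta ('D_v f x)).
  rewrite linear_sum; apply: eq_bigr => j _.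
  by rewrite linearZ /F /= (deriveE 'e_j dhx).
apply: Ck_on_sum => // j; apply: (Ck_onM oU).
  exact: (smooth_on_coord j oU (smooth_on_derive v sf) k).
exact: (IHk _ (smooth_on_derive 'e_j sh)).
Qed.

(** * Smooth maps between manifolds: composition, chain rule, invariance of dimension *)

Section SmoothMaps.
Context {R : realType}.

Lemma sub_smooth_on (m : nat) (W : normedModType R) (U U' : set 'rV[R]_m)
    (f : 'rV[R]_m -> W) : U' `<=` U -> smooth_on U f -> smooth_on U' f.
Proof.
move=> sU sf k; move: (sf k); elim: k f {sf} => [|k IHk] f /=.
  by move=> cf x /sU; exact: cf.
by move=> [df Df]; split=> [x /sU|v]; [exact: df|exact: IHk (Df v)].
Qed.

(** [f] and its derivatives are total functions and [Ck_on] constrains them point by point, so any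
    set containing [x] carries all the information at [x]. *)
Lemma smooth_on_local (m : nat) (W : normedModType R) (U : set 'rV[R]_m)
    (f : 'rV[R]_m -> W) :
  (forall x, U x -> exists2 U' : set 'rV[R]_m, U' x & smooth_on U' f) ->
  smooth_on U f.
Proof.
move=> lf k.
have : forall x, U x -> exists2 U' : set 'rV[R]_m, U' x & Ck_on k U' f.
  by move=> x /lf [U' U'x sf]; exists U'.
elim: k f {lf} => [|k IHk] f lf /=.
  by move=> x Ux; have [U' U'x cf] := lf x Ux; exact: cf.
split=> [x Ux|v]; first by have [U' U'x [df _]] := lf x Ux; exact: df.
apply: IHk => x Ux; have [U' U'x [_ Df]] := lf x Ux; exists U' => //.
exact: Df.
Qed.

Lemma smooth_map_differentiable (m n : nat) (M : smoothManifoldType R m)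
    (N : smoothManifoldType R n) (F : M -> N) (c : chart R m M)
    (d : chart R n N) (p : M) :
  smooth_map F -> atlas c -> atlas d -> chart_dom c p -> chart_dom d (F p) ->
  differentiable (d \o F \o chart_inv c) (c p).
Proof.
move=> [_ sF] ac ad cp dFp; apply: smooth_on_differentiable (sF c d ac ad) _.
by exists p.
Qed.

Section Composition.
Variables (l m n : nat) (M : smoothManifoldType R l).
Variables (N : smoothManifoldType R m) (P : smoothManifoldType R n).
Variables (F : M -> N) (G : N -> P).
Hypotheses (sF : smooth_map F) (sG : smooth_map G).

(** Charts and their inverses take arbitrary values off their domains, so coordinate expressions
    compose as in [comp_chartE] only on this set. *)
Let overlap (c : chart R l M) (d : chart R m N) (e : chart R n P) :=
  c @` (chart_dom c `&` F @^-1` (chart_dom d `&` G @^-1` chart_dom e)).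

Let overlap_open c d e : open (overlap c d e).
Proof.
apply: chart_image_open; apply: open_comp => [x _|]; first exact: sF.1.
apply: openI; first exact: chart_dom_open.
by apply: open_comp => [x _|]; [exact: sG.1|exact: chart_dom_open].
Qed.

Let comp_chartE c d e x : overlap c d e x ->
  ((e \o G \o chart_inv d) \o (d \o F \o chart_inv c)) x =
  (e \o (G \o F) \o chart_inv c) x.
Proof. by move=> [p [cp [dp ep]] <-] /=; rewrite chart_funK ?chart_funK. Qed.

(** No single chart of [N] need cover the image of [c], hence the localisation: near [p] the
    expression factors through the chart at [F p]. *)
Lemma smooth_map_comp : smooth_map (G \o F).
Proof.
split=> [x|c e ac ae].
  by apply: continuous_comp; [exact: sF.1|exact: sG.1].
apply: smooth_on_local => _ [p [cp eGFp] <-].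
pose d := chart_at (F p).
have ad : atlas d by exact: chart_at_atlas.
exists (overlap c d e).
  by exists p => //; split=> //; split=> //; exact: chart_at_dom.
apply: eq_smooth_on (@comp_chartE c d e) _ => //.
apply: (@smooth_on_comp _ _ _ _ _ (d @` (chart_dom d `&` G @^-1` chart_dom e))).
- exact: overlap_open.
- apply: chart_image_open; apply: open_comp => [x _|]; first exact: sG.1.
  exact: chart_dom_open.
- move=> _ [q [cq [dq eq]] <-] /=; exists (F q); rewrite ?chart_funK//.
- apply: sub_smooth_on (sF.2 c d ac ad) => _ [q [cq [dq _]] <-].
  by exists q.
- exact: sG.2.
Qed.

Lemma mdiff_comp (p : M) (u : tangent p) :
  mdiff (G \o F) p u = mdiff G (F p) (mdiff F p u).
Proof.
pose c := chart_at p; pose d := chart_at (F p); pose e := chart_at (G (F p)).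
symmetry; apply: diff_chain.
- by rewrite /= chart_funK //; exact: chart_at_dom.
- apply: smooth_map_differentiable => //;
    by [exact: chart_at_atlas|exact: chart_at_dom].
- apply: smooth_map_differentiable => //;
    by [exact: chart_at_atlas|exact: chart_at_dom].
(* The two coordinate expressions agree only on the overlap, but agreement near [c p] determines the
   differential. *)
have : nbhs (c p) (overlap c d e).
  apply: open_nbhs_nbhs; split=> //; exists p => //.
  by split; [|split]; exact: chart_at_dom.
by apply: filterS => x; exact: comp_chartE.
Qed.
End Composition.

Lemma mdiff_id (m : nat) (M : smoothManifoldType R m) (p : M) (u : tangent p) :
  mdiff (id : M -> M) p u = u.
Proof.
pose c := chart_at p.
have idc : {near c p, id =1 c \o id \o chart_inv c}.
  have : nbhs (c p) (c @` chart_dom c).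
    apply: open_nbhs_nbhs; split; first exact: chart_img_open.
    by exists p => //; exact: chart_at_dom.
  by apply: filterS => _ [q cq <-] /=; rewrite chart_funK.
by rewrite /mdiff (near_eq_diff idc _).2// diff_val.
Qed.

(** The sides belong to [tangent (F p)] and [tangent (G p)], so they are compared in the common
    coordinate space. *)
Lemma eq_mdiff (m n : nat) (M : smoothManifoldType R m)
    (N : smoothManifoldType R n) (F G : M -> N) (p : M) (u : tangent p) :
  F =1 G -> mdiff F p u = mdiff G p u :> 'rV[R]_n.
Proof. by move=> /funext ->. Qed.

Lemma diffeomorphism_comp (l m n : nat) (M : smoothManifoldType R l)
    (N : smoothManifoldType R m) (P : smoothManifoldType R n)
    (F : M -> N) (G : N -> P) :
  diffeomorphism F -> diffeomorphism G -> diffeomorphism (G \o F).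
Proof.
move=> [F' [FK F'K sF sF']] [G' [GK G'K sG sG']]; exists (F' \o G').
by split; [exact: can_comp|exact: can_comp|exact: smooth_map_comp|
           exact: smooth_map_comp].
Qed.

(** By the chain rule the differential at the given point has a left inverse, and so does the
    differential of the inverse map; this bounds each dimension by the other. *)
Lemma diffeomorphism_dim (m n : nat) (M : smoothManifoldType R m)
    (N : smoothManifoldType R n) (F : M -> N) :
  M -> diffeomorphism F -> m = n.
Proof.
move=> p [F' [FK F'K sF sF']].
have le_dim (k l : nat) (f : {linear 'rV[R]_k -> 'rV[R]_l})
    (f' : {linear 'rV[R]_l -> 'rV[R]_k}) : cancel f f' -> (k <= l)%N.
  move=> fK; apply: (@mulmx1_min _ _ _ (lin1_mx f) (lin1_mx f')).
  apply/row_matrixP => i.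
  by rewrite rowE mulmxA !mul_rV_lin1 fK rowE mulmx1.
have dK : cancel (mdiff F p) (mdiff F' (F p)).
  move=> u; rewrite -(mdiff_comp sF sF') -[RHS]mdiff_id.
  exact: eq_mdiff.
have dK' : cancel (mdiff F' (F p)) (mdiff F (F' (F p))).
  move=> u; rewrite -(mdiff_comp sF' sF) -[RHS]mdiff_id.
  exact: eq_mdiff.
by apply/eqP; rewrite eqn_leq (le_dim _ _ _ _ dK) (le_dim _ _ _ _ dK').
Qed.

End SmoothMaps.

(** * Linear maps as smooth maps, and additive differentiable maps *)

Section LinearMaps.
Context {R : realType}.

Section LinearMap.
Variables (V W : vectType R) (f : {linear V -> W}).
Local Notation fM := (f : vmanifold V -> vmanifold W).

Let f_in : {linear 'rV[R]_(\dim {:V}) -> 'rV[R]_(\dim {:W})} :=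
  rVof (vbasis {:W}) \o f \o vecof (vbasis {:V}).

(** In the only chart of each space the map is the linear map [f_in] on rows; continuity is carried
    back through the charts. *)
Lemma vmanifold_linear_smooth : smooth_map fM.
Proof.
split=> [v|c d -> ->]; last first.
  apply: (@smooth_on_linear _ _ _ _ f_in _); apply: chart_image_open.
  by rewrite preimage_setT; exact: openT.
have -> : fM = chart_inv vchart \o f_in \o vchart.
  by rewrite funeqE => w /=; rewrite !rVofK//; exact: vbasisP.
apply: continuous_comp; first exact: chart_fun_continuous.
apply: continuous_comp; first exact: rV_linear_continuous.
apply: (chart_inv_continuous (c := vchart)).
by exists (f v) => //=; rewrite rVofK//; exact: vbasisP.
Qed.

Lemma tangent_vect_mdiff_linear (v : vmanifold V) (u : tangent v) :
  tangent_vect (mdiff fM v u) = f (tangent_vect u).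
Proof.
have -> : mdiff fM v u = f_in u.
  have cf_in : continuous f_in by exact: rV_linear_continuous.
  exact: (congr1 (@^~ u) (diff_lin (vchart v) cf_in)).
by rewrite /tangent_vect /= rVofK//; exact: vbasisP.
Qed.

End LinearMap.

Lemma vmanifold_linear_diffeomorphism (V W : vectType R) (f : {linear V -> W})
    (f' : {linear W -> V}) : cancel f f' -> cancel f' f ->
  diffeomorphism (f : vmanifold V -> vmanifold W).
Proof.
move=> fK f'K; exists (f' : vmanifold W -> vmanifold V).
by split=> //; exact: vmanifold_linear_smooth.
Qed.

(* Differentiability at 0 suffices: [df v = lim k * f (v / k) = f v]. *)
Lemma additive_differentiable (V W : normedModType R) (f : V -> W) :
  {morph f : x y / x + y} -> differentiable f 0 -> f = 'd f 0 :> (V -> W).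
Proof.
move=> fD df; apply/funext => v.
have f0 : f 0 = 0 by apply: (addIr (f 0)); rewrite -fD !add0r.
have fMn k w : f (w *+ k) = f w *+ k.
  by elim: k => [|k IHk]; rewrite ?mulr0n// !mulrS fD IHk.
suff small e : 0 < e -> `|f v - 'd f 0 v| <= e * `|v|.
  apply/eqP; rewrite -subr_eq0 -normr_le0; apply/ler_addgt0Pr => e e0.
  (* The added 1 keeps the divisor positive when [v] is 0. *)
  have v1 : 0 < `|v| + 1 by rewrite ltr_wpDl.
  rewrite add0r (le_trans (small (e / (`|v| + 1)) _)) ?divr_gt0//.
  by rewrite mulrAC ler_pdivrMr// ler_pM2l// lerDl.
move=> e0; have /eqaddoP/(_ e e0) near_df := diff_locally df.
have v_cvg0 : harmonic k *: v @[k --> \oo] --> (0 : V).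
  by rewrite -(scale0r v); apply: cvgZr_tmp; exact: cvg_harmonic.
have /filter_ex[k] : \forall k \near \oo,
    `|(f \o shift 0 - (cst (f 0) + 'd f 0)) (harmonic k *: v)| <=
    e * `|harmonic k *: v| := v_cvg0 _ near_df.
rewrite !fctE /= f0 add0r addr0 => fk.
have k0 : 0 < k.+1%:R :> R by [].
have vE : v = harmonic k *: v *+ k.+1.
  by rewrite -scaler_nat scalerA /harmonic /= divff ?scale1r// gt_eqF.
rewrite vE fMn raddfMn -mulrnBl !normrMn mulrnAr.
by rewrite ler_pMn2r.
Qed.
End LinearMaps.

(** * Orthonormal bases and linear isometries *)

Section OrthonormalBases.
Context {R : realType}.

Section OrthonormalBasis.
Variables (V : vectType R) (ip : {dot V for idfun}).

Definition orthonormal_family (k : nat) (X : 'I_k -> V) :=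
  forall i j, ip (X i) (X j) = (i == j)%:R.

Definition orthonormal_proj (k : nat) (X : 'I_k -> V) (v : V) : V :=
  \sum_i ip v (X i) *: X i.

Let ipC u v : ip u v = ip v u.
Proof. by rewrite hermC expr0 mul1r. Qed.

Lemma orthonormal_proj_ip k (X : 'I_k -> V) v j :
  orthonormal_family X -> ip (orthonormal_proj X v) (X j) = ip v (X j).
Proof.
move=> oX; rewrite linear_sumlz (bigD1 j)//= big1 => [|i ij].
  by rewrite linearZl_LR /= oX eqxx mulr1 addr0.
by rewrite linearZl_LR /= oX (negbTE ij) mulr0.
Qed.

(** One Gram-Schmidt step: the nonzero residual of [v] is orthogonal to the family, and once
    normalised it is inserted at index [ord0]. *)
Lemma orthonormal_extend k (X : 'I_k -> V) v :
  orthonormal_family X -> orthonormal_proj X v != v ->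
  exists Y : 'I_k.+1 -> V, orthonormal_family Y.
Proof.
move=> oX Xv; pose w := v - orthonormal_proj X v.
have w0 : w != 0 by rewrite subr_eq0 eq_sym.
have wX i : ip w (X i) = 0.
  by rewrite linearBl /= orthonormal_proj_ip// subrr.
have w_gt0 : 0 < ip w w by exact: neq0_dnorm_gt0.
pose e := (Num.sqrt (ip w w))^-1 *: w.
have eX i : ip e (X i) = 0 by rewrite linearZl_LR /= wX mulr0.
have ee : ip e e = 1.
  rewrite linearZl_LR /= linearZr_LR /= mulrA -expr2 exprVn sqr_sqrtr ?ltW//.
  by rewrite mulVf// gt_eqF.
exists (fun i => if unlift ord0 i is Some j then X j else e) => i j.
case: (unliftP ord0 i) => [i'|] ->; case: (unliftP ord0 j) => [j'|] ->.
- by rewrite oX (inj_eq lift_inj).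
- by rewrite ipC eX eq_sym (negbTE (neq_lift _ _)).
- by rewrite eX (negbTE (neq_lift _ _)).
- by rewrite ee eqxx.
Qed.

(** Pairing a vanishing combination with [X i] isolates its coefficient at [i], so the family is
    free. *)
Lemma orthonormal_family_dim k (X : 'I_k -> V) :
  orthonormal_family X -> (k <= \dim {:V})%N.
Proof.
move=> oX.
have /eqP dX : free [tuple X i | i < k].
  apply/freeP => a aX i.
  have := linear0l ip (X i).
  rewrite -aX linear_sumlz (bigD1 i)//= big1 => [|j ji].
    by rewrite linearZl_LR /= nth_mktuple oX eqxx mulr1 addr0.
  by rewrite linearZl_LR /= nth_mktuple oX (negbTE ji) mulr0.
by have := dimvS (subvf <<[tuple X i | i < k]>>%VS); rewrite dX size_tuple.
Qed.

(** While [k] is below the dimension, the family cannot span, so some vector differs from its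
    projection and the family extends. At full size such a vector would yield a family exceeding the
    dimension. *)
Lemma orthonormal_basis_exists :
  exists X : 'I_(\dim {:V}) -> V,
    orthonormal_family X /\ forall v, orthonormal_proj X v = v.
Proof.
have extend k : (k <= \dim {:V})%N ->
    exists X : 'I_k -> V, orthonormal_family X.
  elim: k => [_|k IHk kV]; first by exists (fun=> 0) => -[].
  have [X oX] := IHk (ltnW kV).
  have [Xid|/existsNP[v /eqP]] := pselect (forall v, orthonormal_proj X v = v).
    move: kV; rewrite ltnNge => /negP[].
    rewrite -[leqRHS](size_tuple [tuple X i | i < k]).
    apply: leq_trans (dimvS _) (dim_span _).
    apply/subvP => v _; rewrite -(Xid v) rpred_sum// => i _; rewrite rpredZ//.
    by rewrite memv_span// -[X i](tnth_mktuple X) mem_tnth.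
  exact: orthonormal_extend.
have [X oX] := extend _ (leqnn _).
exists X; split=> // v; apply: contrapT => /eqP /(orthonormal_extend oX)[Y oY].
by have := orthonormal_family_dim oY; rewrite ltnn.
Qed.

End OrthonormalBasis.
End OrthonormalBases.

Lemma linear_isometry_exists (R : realType) (V W : vectType R)
    (ipV : {dot V for idfun}) (ipW : {dot W for idfun}) :
  \dim {:V} = \dim {:W} ->
  exists f : {linear V -> W}, isometry ipW ipV f.
Proof.
move=> dimVW; have [X [_ Xid]] := orthonormal_basis_exists ipV.
have [Y [oY _]] := orthonormal_basis_exists ipW.
(* Both families are now indexed by the same ordinal type, so [X i] can be matched with [Y i]. *)
move: Y oY; rewrite -dimVW => Y oY.
pose f v := \sum_i ipV v (X i) *: Y i.
have f_linear : linear f.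
  move=> a u v; rewrite /f scaler_sumr -big_split; apply: eq_bigr => i _ /=.
  by rewrite linearPl scalerDl scalerA.
pose fL : {linear V -> W} :=
  HB.pack f (GRing.isLinear.Build _ _ _ _ f f_linear).
exists fL => u v; rewrite -[in RHS](Xid u) linear_sumlz linear_sumlz.
apply: eq_bigr => i _; rewrite !linearZl_LR /=; congr (_ * _).
rewrite [RHS](hermC ipV) expr0 mul1r /= /f.
rewrite linear_sumr (bigD1 i)//= big1 => [|j ji].
  by rewrite linearZr_LR /= oY eqxx mulr1 addr0.
by rewrite linearZr_LR /= oY eq_sym (negbTE ji) mulr0.
Qed.

(** Positive definiteness makes [f] injective, and equality of dimensions then makes it
    surjective. *)
Lemma linear_isometry_inv (R : realType) (V W : vectType R)
    (ipV : {dot V for idfun}) (ipW : {dot W for idfun}) (f : {linear V -> W}) :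
  \dim {:V} = \dim {:W} -> isometry ipW ipV f ->
  exists2 f' : {linear W -> V}, cancel f f' & cancel f' f.
Proof.
move=> dimVW f_iso; have f_inj : injective f.
  move=> u v fuv; apply/eqP; rewrite -subr_eq0; apply: contraPT isT => uv.
  have := neq0_dnorm_gt0 (s := ipV) _ uv.
  by rewrite -f_iso linearB fuv subrr linear0l ltxx.
have f_ker : lker (linfun f) == 0%VS.
  by apply/lker0P => u v; rewrite !lfunE; exact: f_inj.
have f_img : limg (linfun f) = fullv.
  by apply/eqP; rewrite eqEdim subvf limg_dim_eq ?(eqP f_ker) ?capv0//= dimVW.
exists (linfun f)^-1%VF => [v|w].
  by have := lker0_lfunK f_ker v; rewrite lfunE.
have /(limg_lfunVK (f := linfun f)) : w \in limg (linfun f).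
  by rewrite f_img memvf.
by rewrite lfunE.
Qed.

(** * Log-Euclidean groups and the maps induced by linear maps *)

Section LogEuclidean.
Context {R : realType} {n : nat} {V : vectType R}.
Variable G : logEuclideanGroupType n V.

Lemma le_log_diffeomorphism : diffeomorphism (le_log : G -> vmanifold V).
Proof.
exists (le_exp : vmanifold V -> G).
by split; [exact: le_logK|exact: le_expK|exact: le_log_smooth|
           exact: le_exp_smooth].
Qed.

Lemma le_exp_diffeomorphism : diffeomorphism (le_exp : vmanifold V -> G).
Proof.
exists (le_log : G -> vmanifold V).
by split; [exact: le_expK|exact: le_logK|exact: le_exp_smooth|
           exact: le_log_smooth].
Qed.

(** Applied to two groups of the same manifold dimension, this equates the dimensions of their Lie
    algebras. *)
Lemma le_log_dim : n = \dim {:V}.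
Proof. exact: diffeomorphism_dim (1%g : G) le_log_diffeomorphism. Qed.

Lemma le_logM (x y : G) : le_log (x * y)%g = le_log x + le_log y :> V.
Proof. by rewrite le_mulE le_expK. Qed.

Lemma le_expD (v w : V) : le_exp (v + w) = (le_exp v * le_exp w)%g :> G.
Proof. by rewrite le_mulE !le_expK. Qed.

End LogEuclidean.

Section LogEuclideanMaps.
Context {R : realType} {m n : nat} {V W : vectType R}.
Variables (G : logEuclideanGroupType m V) (H : logEuclideanGroupType n W).
Variable f : {linear V -> W}.
Let Phi : G -> H := le_exp \o f \o le_log.

(** The chain rule is applied to both sides of [le_log \o Phi = f \o le_log]; the differential of
    [f] is [f] itself at every point. *)
Lemma le_dlog_mdiff (p : G) (u : tangent p) :
  le_dlog (mdiff Phi p u) = f (le_dlog u).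
Proof.
have slog := le_log_smooth (s := G); have sexp := le_exp_smooth (s := H).
have sf := vmanifold_linear_smooth f.
have sPhi : smooth_map Phi.
  exact: (smooth_map_comp slog (smooth_map_comp sf sexp)).
rewrite /le_dlog -tangent_vect_mdiff_linear /tangent_vect.
rewrite -(mdiff_comp slog sf) -(mdiff_comp sPhi (le_log_smooth (s := H))).
have logPhi : (le_log \o Phi : G -> vmanifold W) =1
    (f \o le_log : G -> vmanifold W) by move=> x /=; rewrite le_expK.
exact: (congr1 (vecof (vbasis {:W})) (eq_mdiff u logPhi)).
Qed.

Lemma le_linear_diffeomorphism (f' : {linear W -> V}) :
  cancel f f' -> cancel f' f -> diffeomorphism Phi.
Proof.
move=> fK f'K.
apply: (diffeomorphism_comp (F := f \o le_log : G -> vmanifold W)).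
  apply: (diffeomorphism_comp (le_log_diffeomorphism G)).
  exact: vmanifold_linear_diffeomorphism fK f'K.
exact: le_exp_diffeomorphism.
Qed.

Lemma le_linear_morph : {morph Phi : x y / (x * y)%g}.
Proof. by move=> x y; rewrite /Phi /= le_logM linearD le_expD. Qed.

Lemma le_morph_unique (Psi : G -> H) :
  smooth_map Psi -> {morph Psi : x y / (x * y)%g} -> lie_differential Psi f ->
  Psi = Phi.
Proof.
move=> sPsi Psi_morph dPsi.
pose F : vmanifold V -> vmanifold W := le_log \o (Psi \o le_exp).
have slog := le_log_smooth (s := H); have sexp := le_exp_smooth (s := G).
have sPsiexp := smooth_map_comp sexp sPsi.
have sF : smooth_map F by exact: smooth_map_comp sPsiexp slog.
have FD (v w : V) : F (v + w) = F v + F w :> W.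
  by rewrite /F /= le_expD Psi_morph le_logM.
(* [V] and [W] carry no norm, so additivity and differentiability are combined on coordinate
   rows. *)
pose F_in : 'rV[R]_(\dim {:V}) -> 'rV[R]_(\dim {:W}) :=
  vchart \o F \o chart_inv vchart.
have F_in_diff : differentiable F_in 0.
  rewrite -(linear0 (rVof (vbasis {:V}))).
  exact: (smooth_map_differentiable (c := vchart) (d := vchart) (p := 0 : V)).
have F_inD : {morph F_in : x y / x + y}.
  by move=> x y; rewrite /F_in /= linearD FD linearD.
have dlog_exp (v : vmanifold V) (u : tangent v) :
    le_dlog (mdiff (le_exp : vmanifold V -> G) v u) = tangent_vect u.
  rewrite /le_dlog -(mdiff_comp sexp (le_log_smooth (s := G))) /tangent_vect.
  rewrite -[in RHS](mdiff_id u).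
  have logexp : (le_log \o (le_exp : V -> G) : vmanifold V -> vmanifold V)
      =1 id by exact: le_expK.
  exact: (congr1 (vecof (vbasis {:V})) (eq_mdiff u logexp)).
(* The chain rule produces the base point [le_exp 0], equal to the identity only by [le_exp0]; a
   variable [p] avoids transporting tangent vectors. *)
have dPsi_at (p : G) (u : tangent p) : p = 1%g ->
    le_dlog (mdiff Psi p u) = f (le_dlog u).
  by move=> p1; move: u; rewrite p1; exact: dPsi.
have dF (u : tangent (0 : vmanifold V)) :
    tangent_vect (mdiff F 0 u) = f (tangent_vect u).
  rewrite /F (mdiff_comp sPsiexp slog) (mdiff_comp sexp sPsi).
  by rewrite -dlog_exp -dPsi_at// le_exp0.
have Ff (v : V) : F v = f v.
  (* The coordinates of [v] are used as a tangent vector at 0, where the differential of [F_in] is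
     [F_in] itself. *)
  have := dF (vchart v); rewrite /tangent_vect /mdiff /=.
  rewrite (linear0 (rVof (vbasis {:V}))).
  have F_inE := additive_differentiable F_inD F_in_diff.
  rewrite -[X in vecof _ X](congr1 (@^~ (vchart v)) F_inE).
  by rewrite /F_in /= !rVofK//; exact: vbasisP.
by apply/funext => x; rewrite /Phi /= -Ff /F /= !le_logK.
Qed.

End LogEuclideanMaps.

Lemma le_linear_isometry (R : realType) (n : nat) (g h : vectType R)
    (G : logEuclideanGroupType n g) (H : logEuclideanGroupType n h)
    (ipg : {dot g for idfun}) (iph : {dot h for idfun})
    (psi : {linear g -> h}) :
  isometry iph ipg psi ->
  riemannian_isometry (log_metric G ipg) (log_metric H iph)
    (le_exp \o psi \o le_log).
Proof.
move=> psi_iso; split=> [|p u v]; last first.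
  by rewrite /= /log_pullback !le_dlog_mdiff psi_iso.
have dim_gh : \dim {:g} = \dim {:h} by rewrite -(le_log_dim G) -(le_log_dim H).
have [psi' psiK psi'K] := linear_isometry_inv dim_gh psi_iso.
exact: le_linear_diffeomorphism psiK psi'K.
Qed.

Theorem theorem3p2 (R : realType) (n : nat) (g h : vectType R)
    (G : logEuclideanGroupType n g) (H : logEuclideanGroupType n h)
    (ipg : {dot g for idfun}) (iph : {dot h for idfun}) :
  (exists Phi : G -> H,
     riemannian_isometry (log_metric G ipg) (log_metric H iph) Phi)
  /\
  (forall psi : {linear g -> h}, isometry iph ipg psi ->
     unique (fun Phi : G -> H =>
               [/\ lie_group_isomorphism Phi,
                   riemannian_isometry (log_metric G ipg) (log_metric H iph) Phi
                 & lie_differential Phi psi])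
            (le_exp \o psi \o le_log)).
Proof.
have dim_gh : \dim {:g} = \dim {:h} by rewrite -(le_log_dim G) -(le_log_dim H).
split=> [|psi psi_iso].
  have [psi psi_iso] := linear_isometry_exists ipg iph dim_gh.
  by exists (le_exp \o psi \o le_log); exact: le_linear_isometry.
have iso := le_linear_isometry G H psi_iso.
split=> [|Phi [[[_ [_ _ sPhi _]] PhiM] _ dPhi]].
  split=> //; last by move=> u; exact: le_dlog_mdiff.
  by split; [exact: iso.1|exact: le_linear_morph].
by symmetry; exact: le_morph_unique.
Qed.
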